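(* Let $\mathfrak{X}=(\Gamma,c:\Gamma^2\to\mathcal{C})$ be a configuration with exactly one empty colour, and let $\Gamma_{\mathfrak{X}}$ be the graph with vertex set $\Gamma$ and edge set $\{(v_1,v_2): c(v_1,v_2)\text{ is a nonempty edge colour}\}$, assumed connected. Suppose there exists an automorphism $\varphi\in\mathrm{Aut}(\mathfrak{X})$, $\varphi\neq\mathrm{Id}$, such that every nontrivial element of the cyclic group $\langle\varphi\rangle$ has no fixed points, and choose such a $\varphi$ with $|\langle\varphi\rangle|$ minimal. Then the number $WL(\mathfrak{X})$ of nontrivial iterations of the Weisfeiler-Leman algorithm applied to $\mathfrak{X}$ satisfies $$WL(\mathfrak{X})\geq\log_2\mathrm{diam}\,\Gamma_{\mathfrak{X}}-\log_2(|\langle\varphi\rangle|-1)-3 .$$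
   Context: A (classical) configuration is a pair $(\Gamma,c)$ with $\Gamma$ a finite set and $c:\Gamma^2\to\mathcal{C}$ a map to a finite set of colours such that: (i) if some $c_0$ satisfies $c(v,v)=c_0$ for some $v$, then $c(v_1,v_2)=c_0$ implies $v_1=v_2$; (ii) for every $c_0\in\mathcal{C}$ there is $c_0^{-1}\in\mathcal{C}$ with $c(v_1,v_2)=c_0\Rightarrow c(v_2,v_1)=c_0^{-1}$. Colours of the form $c(v,v)$ are vertex colours, the others edge colours. An edge colour $c_0$ is nonempty if for every $v$ there is at most one $w$ with $c(v,w)=c_0$, and empty otherwise. An automorphism of $\mathfrak{X}$ is a bijection $\sigma$ of $\Gamma$ with $c(\sigma v_1,\sigma v_2)=c(v_1,v_2)$ for all $v_1,v_2$. Connectedness of $\Gamma_{\mathfrak{X}}$ means any vertex can be reached from any other by a directed path; $\mathrm{diam}\,\Gamma_{\mathfrak{X}}$ is the maximum over ordered pairs of the length of a shortest directed path. Weisfeiler-Leman algorithm: $c^{(0)}=c$, $\mathcal{C}^{(0)}=\mathcal{C}$, and $c^{(h+1)}(v_1,v_2)$ is the tuple consisting of $c^{(h)}(v_1,v_2)$ together with the numbers $\left|\{w: c^{(h)}(v_1,w)=c_1,\ c^{(h)}(w,v_2)=c_2\}\right|$ for all $(c_1,c_2)\in\mathcal{C}^{(h)}\times\mathcal{C}^{(h)}$; $\mathcal{C}^{(h+1)}$ is the set of values of $c^{(h+1)}$. $WL(\mathfrak{X})$ is the least $h\geq0$ such that the partition of $\Gamma^2$ into colour classes of $c^{(h+1)}$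 equals that of $c^{(h)}$. *)

(* Defs.v *)
From HB Require Import structures.
From mathcomp Require Import all_boot all_order all_algebra all_fingroup.
From mathcomp Require Import reals exp.
Set Implicit Arguments.
Unset Strict Implicit.
Unset Printing Implicit Defensive.

Section Configurations.
Variables (G C : finType).

Record configuration := Configuration {
  colour : G * G -> C;
  colour_vertex : forall v v1 v2, colour (v1, v2) = colour (v, v) -> v1 = v2;
  colour_inverse : forall c0, exists c0inv,
    forall v1 v2, colour (v1, v2) = c0 -> colour (v2, v1) = c0inv }.

Variable X : configuration.

Definition vertex_colour (c0 : C) : bool := [exists v, colour X (v, v) == c0].
Definition edge_colour (c0 : C) : bool := ~~ vertex_colour c0.

Definition at_most_one_out (c0 : C) : bool :=
  [forall v, #|[set w | colour X (v, w) == c0]| <= 1].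
Definition nonempty_colour (c0 : C) : bool :=
  edge_colour c0 && at_most_one_out c0.
Definition empty_colour (c0 : C) : bool :=
  edge_colour c0 && ~~ at_most_one_out c0.

Definition conf_graph : rel G := [rel v1 v2 | nonempty_colour (colour X (v1, v2))].

Definition conf_Aut : {set {perm G}} :=
  [set s : {perm G} |
    [forall v1, forall v2, colour X (s v1, s v2) == colour X (v1, v2)]].

Definition nontrivial_powers_fixfree (s : {perm G}) : Prop :=
  forall t : {perm G}, t \in <[s]>%g -> t != 1%g -> forall v, t v != v.

Definition fixfree_aut (s : {perm G}) : Prop :=
  [/\ s \in conf_Aut, s != 1%g & nontrivial_powers_fixfree s].

End Configurations.

Section Diameter.
Variables (T : finType) (e : rel T).

Definition strongly_connected : Prop := forall u v : T, connect e u v.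

Definition has_path (u v : T) (n : nat) : bool :=
  [exists p : n.-tuple T, path e u p && (last u p == v)].

Lemma has_path_exists : strongly_connected -> forall u v, exists n, has_path u v n.
Proof.
move=> conn u v; have /connectP[p ep ->] := conn u v.
by exists (size p); apply/existsP; exists (in_tuple p); rewrite ep eqxx.
Qed.

Variable conn : strongly_connected.

Definition dist (u v : T) : nat := ex_minn (has_path_exists conn u v).

Definition diam : nat := \max_(uv : T * T) dist uv.1 uv.2.

End Diameter.

Section WeisfeilerLeman.
Variable G : finType.

Record colouring := Colouring { col_set : finType; col_fun : G * G -> col_set }.

Section Step.
Variable K : colouring.

Definition refined_colour (v : G * G) :
    col_set K * {ffun col_set K * col_set K -> nat} :=
  (col_fun K v,
   [ffun c12 : col_set K * col_set K =>
     #|[set w | (col_fun K (v.1, w) == c12.1) && (col_fun K (w, v.2) == c12.2)]|]).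

(* The new colour set is exactly the set of values of [refined_colour]. *)
Definition wl_step : colouring :=
  @Colouring (seq_sub (codom refined_colour))
    (fun v => SeqSub (codom_f refined_colour v)).

End Step.

Definition wl_iter (K : colouring) (h : nat) : colouring := iter h wl_step K.

Definition colour_partition (K : colouring) : {set {set G * G}} :=
  preim_partition (col_fun K) [set: G * G].

Definition wl_stable (K : colouring) (h : nat) : bool :=
  colour_partition (wl_iter K h.+1) == colour_partition (wl_iter K h).

Definition same_colour (K : colouring) : {set (G * G) * (G * G)} :=
  [set x | col_fun K x.1 == col_fun K x.2].

Lemma same_colour_step K : same_colour (wl_step K) \subset same_colour K.
Proof.
apply/subsetP=> x; rewrite !inE => /eqP /(congr1 val) /=.
by case=> ->.
Qed.

Lemma same_colour_partition K L :
  same_colour K = same_colour L -> colour_partition K = colour_partition L.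
Proof.
move=> eqKL; apply: eq_imset => x; apply/setP=> y; rewrite !inE /=.
by have := congr1 (fun A : {set _} => (x, y) \in A) eqKL; rewrite !inE /= => ->.
Qed.

Lemma wl_stable_exists K : exists h, wl_stable K h.
Proof.
case: (boolP [exists h : 'I_(#|same_colour K|.+1), wl_stable K h]).
  by case/existsP=> h ?; exists h.
rewrite negb_exists => /forallP nst.
have dec h : h <= #|same_colour K|.+1 ->
    #|same_colour (wl_iter K h)| + h <= #|same_colour K|.
  elim: h => [|h IH] lth; first by rewrite addn0.
  apply: leq_trans (IH (ltnW lth)); rewrite addnS ltn_add2r.
  apply: proper_card; rewrite properEneq same_colour_step andbT.
  apply/eqP => /same_colour_partition eqp.
  by have := nst (Ordinal lth); rewrite /wl_stable /= eqp eqxx.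
have := dec _ (leqnn _); rewrite addnS => le.
by have := leq_ltn_trans (leq_addl _ _) le; rewrite ltnn.
Qed.

Definition wl_number (K : colouring) : nat := ex_minn (wl_stable_exists K).

End WeisfeilerLeman.

Definition WL (G C : finType) (X : configuration G C) : nat :=
  wl_number (Colouring (colour X)).

Definition log2 (R : realType) (x : R) : R := (ln x / ln 2%:R)%R.

(* Main.v *)
(** Write [d] for the distance in [conf_graph X] and [c_h] for the [h]-th
    Weisfeiler-Leman colouring. By induction on [h], if [a] is an automorphism
    and both [d v w] and [d v (a w)] exceed [2 ^ h], then
    [c_h (v, w) = c_h (v, a w)]: in the inductive step the balls of radius
    [2 ^ h] around [v] and [w] are disjoint, points of the first are matched by
    the identity, points of the second by [a], and the remaining points orbit by
    orbit, each orbit meeting the two balls around [w] and [a w] equally often.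
    On the other hand, in a stable colouring a colour determines the sequences
    of edge colours of all walks between its endpoints, and such a sequence
    together with the origin determines the endpoint, so [c_h (v, w) = c_h (v, w')]
    forces [w = w']. Finally, if the diameter exceeds [8 * 2 ^ h], then for
    a diametral pair [v], [w] either [v] or the midpoint of a geodesic from [v]
    to [w] is at distance more than [2 ^ h] from both [w] and [phi w]. *)
Require Import Defs.
From mathcomp Require Import all_boot all_order all_algebra all_fingroup.
From mathcomp Require Import reals exp.
From mathcomp Require Import zify.
Import Order.TTheory GRing.Theory Num.Theory.
Set Implicit Arguments.
Unset Strict Implicit.
Unset Printing Implicit Defensive.

(** * Directed distance in a graph *)

Section GraphDistance.
Variables (T : finType) (e : rel T).

Lemma has_pathP u v n :
  reflect (exists p, [/\ path e u p, last u p = v & size p = n]) (has_path e u v n).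
Proof.
apply: (iffP existsP) => [[p /andP[ep /eqP lp]]|[p [ep lp sp]]].
  by exists p; rewrite size_tuple.
by move/eqP: sp => sp; exists (Tuple sp); rewrite /= ep lp eqxx.
Qed.

Lemma has_path_cat u v w m n :
  has_path e u v m -> has_path e v w n -> has_path e u w (m + n).
Proof.
move=> /has_pathP[p [ep lp <-]] /has_pathP[q [eq lq <-]]; apply/has_pathP.
by exists (p ++ q); rewrite cat_path last_cat size_cat ep lp eq.
Qed.

Lemma has_path_split u w m n :
  has_path e u w (m + n) -> exists2 v, has_path e u v m & has_path e v w n.
Proof.
move=> /has_pathP[p [ep lp sp]]; exists (last u (take m p)).
all: move: ep lp; rewrite -{1 2}[p](cat_take_drop m) cat_path last_cat.
all: move=> /andP[ep1 ep2] lp; apply/has_pathP.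
  by exists (take m p); split=> //; rewrite size_takel // sp leq_addr.
by exists (drop m p); split=> //; rewrite size_drop sp addKn.
Qed.

Lemma has_path_sym u v n : symmetric e -> has_path e u v n -> has_path e v u n.
Proof.
move=> sym_e /has_pathP[p [ep <- <-]]; apply/has_pathP.
exists (rev (belast u p)); split; last by rewrite size_rev size_belast.
  by rewrite rev_path (eq_path (e' := e)) // => x y; rewrite sym_e.
by case: p {ep} => // x p; rewrite /= rev_cons last_rcons.
Qed.

Lemma has_path_map (f : T -> T) u v n :
  (forall x y, e (f x) (f y) = e x y) ->
  has_path e u v n -> has_path e (f u) (f v) n.
Proof.
move=> fe /has_pathP[p [ep <- <-]]; apply/has_pathP; exists (map f p).
rewrite last_map size_map; split=> //.
by rewrite path_map (eq_path (e' := e)).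
Qed.

Variable conn : strongly_connected e.

Lemma dist_has_path u v : has_path e u v (dist conn u v).
Proof. by rewrite /dist; case: ex_minnP. Qed.

Lemma dist_le u v n : has_path e u v n -> dist conn u v <= n.
Proof. by rewrite /dist; case: ex_minnP => m _ h /h. Qed.

Lemma dist_triangle v u w : dist conn u w <= dist conn u v + dist conn v w.
Proof. exact: dist_le (has_path_cat (dist_has_path _ _) (dist_has_path _ _)). Qed.

Lemma dist_sym u v : symmetric e -> dist conn u v = dist conn v u.
Proof.
move=> sym_e; apply/eqP; rewrite eqn_leq.
by rewrite !dist_le // has_path_sym // dist_has_path.
Qed.

Lemma dist_perm (s : {perm T}) u v :
  (forall x y, e (s x) (s y) = e x y) -> dist conn (s u) (s v) = dist conn u v.
Proof.
move=> se; apply/eqP; rewrite eqn_leq !dist_le //.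
  have := @has_path_map (s^-1)%g (s u) (s v) (dist conn (s u) (s v)).
  rewrite !permK; apply; last exact: dist_has_path.
  by move=> x y; rewrite -se !permKV.
exact: has_path_map (dist_has_path _ _).
Qed.

(** The empty path and a single edge bound the distance by 0 and 1. This feeds the base case below,
    where the threshold is [2 ^ 0]. *)
Lemma dist_gt1 u v : 1 < dist conn u v -> u != v /\ ~~ e u v.
Proof.
rewrite ltnNge => far_uv; split.
  apply: contra far_uv => /eqP->.
  by apply: (@leq_trans 0) => //; apply/dist_le/has_pathP; exists [::].
apply: contra far_uv => euv.
by apply/dist_le/has_pathP; exists [:: v]; rewrite /= euv.
Qed.

Lemma diam_leP n : (forall u v, dist conn u v <= n) -> diam conn <= n.
Proof. by move=> le_n; apply/bigmax_leqP => uv _; apply: le_n. Qed.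

End GraphDistance.

(** * Weisfeiler-Leman refinement *)

Section Refinement.
Variable G : finType.
Implicit Types (K : colouring G) (p q : G * G).

Lemma wl_stepP K p q :
  col_fun (wl_step K) p = col_fun (wl_step K) q <->
  col_fun K p = col_fun K q /\
  forall c1 c2,
    #|[set x | (col_fun K (p.1, x) == c1) && (col_fun K (x, p.2) == c2)]| =
    #|[set x | (col_fun K (q.1, x) == c1) && (col_fun K (x, q.2) == c2)]|.
Proof.
split=> [/(congr1 val)[-> /ffunP eq_pq]|[eqK eq_pq]].
  by split=> // c1 c2; have := eq_pq (c1, c2); rewrite !ffunE.
apply: val_inj; congr (_, _) => //.
by apply/ffunP => -[c1 c2]; rewrite !ffunE.
Qed.

Lemma wl_iterS K h : wl_iter K h.+1 = wl_step (wl_iter K h).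
Proof. by []. Qed.

Lemma wl_iter_refines K h p q :
  col_fun (wl_iter K h) p = col_fun (wl_iter K h) q -> col_fun K p = col_fun K q.
Proof. by elim: h => // h IH; rewrite wl_iterS => /wl_stepP[/IH]. Qed.

(** Stability is an equality of partitions; membership in a [pblock] turns it into a statement about
    colours. *)
Lemma wl_stable_step K h p q : wl_stable K h ->
  col_fun (wl_iter K h) p = col_fun (wl_iter K h) q ->
  col_fun (wl_iter K h.+1) p = col_fun (wl_iter K h.+1) q.
Proof.
move=> /eqP eq_part eq_pq.
have classE L x y : (y \in pblock (colour_partition L) x) = (col_fun L x == col_fun L y).
  rewrite pblock_equivalence_partition ?inE //.
  by move=> a b c _ _ _; split=> // /eqP->.
by apply/eqP; rewrite -classE eq_part classE eq_pq.
Qed.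

Definition preserves_colour K (s : {perm G}) :=
  forall x y, col_fun K (s x, s y) = col_fun K (x, y).

Lemma wl_iter_perm K h (s : {perm G}) :
  preserves_colour K s -> preserves_colour (wl_iter K h) s.
Proof.
move=> sK; elim: h => // h IH x y; rewrite wl_iterS; apply/wl_stepP.
split=> [|c1 c2] /=; first exact: IH.
rewrite -[LHS](card_preimset _ (@perm_inj _ s)).
by congr #|pred_of_set _|; apply/setP => z; rewrite !inE !IH.
Qed.

(** * Colours of far pairs under a group of isometries *)

Variables (K : colouring G) (A : {group {perm G}}) (d : G -> G -> nat).
Hypothesis A_colour : forall a, a \in A -> preserves_colour K a.
Hypothesis d_sym : forall x y, d x y = d y x.
Hypothesis d_triangle : forall y x z, d x z <= d x y + d y z.
Hypothesis d_A : forall a, a \in A -> forall x y, d (a x) (a y) = d x y.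
Hypothesis colour_far : forall x y x' y',
  1 < d x y -> 1 < d x' y' -> col_fun K (x, y) = col_fun K (x', y').

Let ball (L : nat) x := [set y | d x y <= L].

Lemma card_orbit_ball L (O : {set G}) a w : a \in A ->
  #|[set x | orbit 'P A x == O] :&: ball L (a w)| =
  #|[set x | orbit 'P A x == O] :&: ball L w|.
Proof.
move=> Aa; rewrite -[LHS](card_preimset _ (@perm_inj _ a)).
congr #|pred_of_set _|; apply/setP => x; rewrite !inE d_A //.
by congr ((_ == _) && _); apply: (orbit_act 'P).
Qed.

(** The ball around [v] misses those around [w] and [a w], so removing it keeps their traces on the
    orbit. These have equal size, hence so do their complements. *)
Lemma card_orbit_outside L (O : {set G}) a v w : a \in A ->
  L.*2 < d v w -> L.*2 < d v (a w) ->
  #|([set x | orbit 'P A x == O] :\: ball L v) :\: ball L w| =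
  #|([set x | orbit 'P A x == O] :\: ball L v) :\: ball L (a w)|.
Proof.
move=> Aa far_vw far_vaw; set P := [set x | _].
have meet u : L.*2 < d v u -> (P :\: ball L v) :&: ball L u = P :&: ball L u.
  move=> far_vu; apply/setP => x; rewrite !inE -ltnNge.
  by have := d_triangle x v u; rewrite (d_sym x u); lia.
have := card_orbit_ball L O w Aa; rewrite -/P -(meet w) // -(meet (a w)) //.
have := cardsID (ball L w) (P :\: ball L v).
have := cardsID (ball L (a w)) (P :\: ball L v).
by lia.
Qed.

Lemma wl_iter_far h a v w : a \in A -> 2 ^ h < d v w -> 2 ^ h < d v (a w) ->
  col_fun (wl_iter K h) (v, w) = col_fun (wl_iter K h) (v, a w).
Proof.
elim: h a v w => [|h IH] a v w Aa far_vw far_vaw; first exact: colour_far.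
have inv b : b \in A -> preserves_colour (wl_iter K h) b.
  by move=> Ab; apply/wl_iter_perm/A_colour.
(* Acting by [b^-1] reduces the case of two moved points to that of a moved second point. *)
have IHl b c x y : b \in A -> c \in A -> 2 ^ h < d x y -> 2 ^ h < d (b x) (c y) ->
    col_fun (wl_iter K h) (b x, c y) = col_fun (wl_iter K h) (x, y).
  move=> Ab Ac far1 far2; have Abc : (c * b^-1)%g \in A by rewrite groupM ?groupV.
  rewrite [RHS](IH (c * b^-1)%g) // ?permM.
    by rewrite -[RHS](inv b) // permKV.
  by rewrite -(d_A Ab) permKV.
rewrite wl_iterS; apply/wl_stepP; split=> [|c1 c2 /=].
  by apply: IH => //; apply: leq_ltn_trans far_vw || apply: leq_ltn_trans far_vaw;
     rewrite leq_exp2l.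
rewrite expnS mul2n in far_vw far_vaw; set L := 2 ^ h in far_vw far_vaw IH IHl *.
set c := col_fun (wl_iter K h).
pose S u := [set x | (c (v, x) == c1) && (c (x, u) == c2)].
have tri x : L < d v x \/ L < d x w by have := d_triangle x v w; lia.
have tri' x : L < d v x \/ L < d x (a w) by have := d_triangle x v (a w); lia.
change (#|S w| = #|S (a w)|).
(* A point near [v] is far from both [w] and [a w], so the induction hypothesis applies with it as
   origin. *)
have near_v : S w :&: ball L v = S (a w) :&: ball L v.
  apply/setP => x; rewrite !inE; case: (leqP (d v x) L) => [le_vx|];
    last by rewrite !andbF.
  by rewrite /c (IH a x w) //; [have := tri x | have := tri' x]; lia.
(* [a] carries the points near [w] to those near [a w]; all of these are far from [v], so
   [c (v, x) = c (v, a x)]. *)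
have near_w : #|(S w :\: ball L v) :&: ball L w| =
    #|(S (a w) :\: ball L v) :&: ball L (a w)|.
  rewrite -[RHS](card_preimset _ (@perm_inj _ a)).
  congr #|pred_of_set _|; apply/setP => x; rewrite !inE d_A // [c (a x, a w)]inv // -/c.
  case: (leqP (d w x) L) => [le_wx|]; last by rewrite !andbF.
  have far_vx : L < d v x by have := tri x; rewrite (d_sym x w); lia.
  have far_vax : L < d v (a x).
    by have := tri' (a x); rewrite d_A // (d_sym x w); lia.
  by rewrite /c (IH a v x) // [d v x <= L]leqNgt far_vx [d v (a x) <= L]leqNgt far_vax.
rewrite -[LHS](cardsID (ball L v)) -[RHS](cardsID (ball L v)) near_v; congr (_ + _).
rewrite -[LHS](cardsID (ball L w)) -[RHS](cardsID (ball L (a w))) near_w; congr (_ + _).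
rewrite -!sum1_card !(partition_big (orbit 'P A) predT) //=.
apply: eq_bigr => O _; rewrite !sum1_card.
pose F u := ([set x | orbit 'P A x == O] :\: ball L v) :\: ball L u.
have cardF : #|F w| = #|F (a w)| by apply: card_orbit_outside.
have partE u : [pred x | (x \in S u :\: ball L v :\: ball L u) && (orbit 'P A x == O)]
             =i S u :&: F u.
  move=> x; rewrite !inE; case: (orbit _ _ _ == O); rewrite ?andbT ?andbF //.
  by rewrite andbA andbC -!andbA; do !bool_congr.
rewrite !(eq_card (partE _)).
have [Fw0|[x0 Fx0]] := set_0Vmem (F w).
  by move/eqP: cardF; rewrite Fw0 cards0 eq_sym cards_eq0 => /eqP->; rewrite !setI0.
(* Outside the balls, membership in [S (b w)] is constant on the orbit and the same for all [b] in
   [A], so [x0] decides it. Only [b = 1] and [b = a] are used. *)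
have memS b x : b \in A -> x \in F (b w) -> (x \in S (b w)) = (x0 \in S w).
  move=> Ab; move: Fx0; rewrite !inE -!ltnNge => /and3P[far_wx0 far_vx0 /eqP <-].
  move=> /and3P[far_bwx far_vx]; rewrite orbit_eq_mem => /orbitP[g Ag /= def_x].
  rewrite -def_x apermE in far_bwx far_vx *.
  rewrite /c -(IH g v x0) // IHl //; first by rewrite d_sym.
  by rewrite d_sym.
have cutS b : b \in A -> S (b w) :&: F (b w) = if x0 \in S w then F (b w) else set0.
  move=> Ab; apply/setP => x; rewrite inE.
  have [Fx|nFx] := boolP (x \in F (b w));
    last by rewrite andbF; case: ifP; rewrite ?(negbTE nFx) ?in_set0.
  by rewrite andbT memS //; case: ifP; rewrite ?Fx ?inE.
have := cutS 1%g (group1 A); rewrite perm1 => ->; rewrite cutS //.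
by case: ifP => // _; rewrite cardF.
Qed.

End Refinement.

(** * Stable colours and the diameter bound for configurations *)

Section Configuration.
Variables (G C : finType) (X : configuration G C).

Lemma conf_graph_inj v x y :
  conf_graph X v x -> colour X (v, x) = colour X (v, y) -> x = y.
Proof.
move=> /andP[_ /forallP/(_ v)/card_le1_eqP out1] eq_xy.
by apply: out1; rewrite inE ?eq_xy.
Qed.

Lemma wl_stable_inj h u w w' : wl_stable (Colouring (colour X)) h ->
  connect (conf_graph X) u w ->
  col_fun (wl_iter (Colouring (colour X)) h) (u, w) =
  col_fun (wl_iter (Colouring (colour X)) h) (u, w') -> w = w'.
Proof.
move=> stable /connectP[p]; elim: p u => [|x p IH] u /=.
  by move=> _ -> /wl_iter_refines /= /esym /colour_vertex.
move=> /andP[eux ep] lp /(wl_stable_step stable).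
rewrite wl_iterS; pose c := col_fun (wl_iter (Colouring (colour X)) h).
move=> /wl_stepP[_ /(_ (c (u, x)) (c (x, w)))] /= eq_card.
(* [x] is counted for [w], so some [y] is counted for [w']; the colour of the edge from [u] to [x]
   forces [y = x]. *)
have : 0 < #|[set y | (c (u, y) == c (u, x)) && (c (y, w) == c (x, w))]|.
  by apply/card_gt0P; exists x; rewrite inE !eqxx.
rewrite eq_card => /card_gt0P[y]; rewrite inE => /andP[/eqP uy /eqP yw'].
move/wl_iter_refines: (esym uy) => /= /(conf_graph_inj eux) def_y.
by rewrite -def_y in yw'; exact: IH ep lp (esym yw').
Qed.

Lemma conf_Aut_colour s : s \in conf_Aut X -> preserves_colour (Colouring (colour X)) s.
Proof. by rewrite inE => /forallP s_aut x y; apply/eqP/(forallP (s_aut x)). Qed.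

Lemma conf_Aut_graph s : s \in conf_Aut X ->
  forall x y, conf_graph X (s x) (s y) = conf_graph X x y.
Proof.
move=> /conf_Aut_colour s_aut x y.
by rewrite /conf_graph /= -[colour X (s x, s y)]/(col_fun (Colouring (colour X)) _) s_aut.
Qed.

Hypothesis one_empty : #|[set c0 : C | empty_colour X c0]| = 1.

(** Vertex colours occur only on the diagonal, so distinct points have an edge colour. *)
Lemma nonadjacent_empty x y :
  x != y -> ~~ conf_graph X x y -> empty_colour X (colour X (x, y)).
Proof.
move=> neq_xy; rewrite /conf_graph /= /nonempty_colour /empty_colour.
have edge : edge_colour X (colour X (x, y)).
  apply: contra neq_xy => /existsP[v /eqP eq_v].
  by apply/eqP; exact: colour_vertex (esym eq_v).
by rewrite edge.
Qed.

Lemma nonadjacent_colour x y x' y' : x != y -> ~~ conf_graph X x y ->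
  x' != y' -> ~~ conf_graph X x' y' -> colour X (x, y) = colour X (x', y').
Proof.
move=> nxy exy nxy' exy'; have /card_le1_eqP : #|[set c0 | empty_colour X c0]| <= 1.
  by rewrite one_empty.
by apply; rewrite inE nonadjacent_empty.
Qed.

(* If [conf_graph X] is not symmetric, the inverse of the empty colour is
   nonempty, so every vertex has at most one non-in-neighbour. *)
Lemma conf_graph_sym_or_diam2 (conn : strongly_connected (conf_graph X)) :
  symmetric (conf_graph X) \/ diam conn <= 2.
Proof.
case: (boolP [forall x, forall y, conf_graph X x y ==> conf_graph X y x]).
  move=> /forallP sym; left=> x y; apply/idP/idP.
    exact/implyP/(forallP (sym x)).
  exact/implyP/(forallP (sym y)).
rewrite negb_forall => /existsP[x]; rewrite negb_forall => /existsP[y].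
rewrite negb_imply => /andP[exy neyx]; right.
have irr u : ~~ conf_graph X u u.
  by rewrite /conf_graph /= negb_and negbK; apply/orP; left; apply/existsP; exists u.
have nyx : y != x by apply: contraTneq exy => ->; apply: irr.
have [c0 invE] := colour_inverse X (colour X (y, x)).
have revE u v : u != v -> ~~ conf_graph X u v -> colour X (v, u) = colour X (x, y).
  by move=> nuv euv; rewrite (invE y x) // (invE u v) //; exact: nonadjacent_colour.
(* Reversed, both pairs bear the nonempty colour of [(x, y)], which determines the endpoint from
   [v]. *)
have uniq_in u u' v : u != v -> ~~ conf_graph X u v ->
    u' != v -> ~~ conf_graph X u' v -> u = u'.
  move=> nuv euv nuv' euv'; apply: (@conf_graph_inj v); last by rewrite !revE.
  by rewrite /conf_graph /= revE.
apply: diam_leP => u v; have [<-|nuv] := eqVneq u v.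
  by apply/(@leq_trans 0)/leq0n/dist_le/has_pathP; exists [::].
have /connectP[[|z p]] := conn u v; first by move=> _ eq_uv; rewrite eq_uv eqxx in nuv.
move=> /= /andP[euz _] _; have [def_v|nzv] := eqVneq z v.
  by apply/(@leq_trans 1)/ltnW/ltnSn/dist_le/has_pathP; exists [:: z]; rewrite /= euz.
have [euv|neuv] := boolP (conf_graph X u v).
  by apply/(@leq_trans 1)/ltnW/ltnSn/dist_le/has_pathP; exists [:: v]; rewrite /= euv.
(* Apart from [v], only [u] has no edge into [v], and [z] differs from [u] as there are no loops. *)
have ezv : conf_graph X z v.
  apply: contraT => /(uniq_in u z v nuv neuv nzv) def_z.
  by move: euz; rewrite def_z (negbTE (irr z)).
by apply/dist_le/has_pathP; exists [:: z; v]; rewrite /= euz ezv.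
Qed.

Lemma diam_le_WL (conn : strongly_connected (conf_graph X)) (phi : {perm G}) :
  phi \in conf_Aut X -> (forall v, phi v != v) -> diam conn <= 2 ^ (WL X + 3).
Proof.
move=> phi_aut phi_ff; rewrite /WL /wl_number; case: ex_minnP => h stable _.
rewrite expnD; have := expn_gt0 2 h; set L := 2 ^ h => /= L_gt0.
have [sym_e|] := conf_graph_sym_or_diam2 conn; last by lia.
have autA a : a \in <[phi]>%g -> a \in conf_Aut X.
  move=> /cycleP[n ->]; elim: n => [|n IH].
    by rewrite inE; apply/forallP => x; apply/forallP => y; rewrite !perm1.
  rewrite inE expgS; apply/forallP => x; apply/forallP => y; apply/eqP; rewrite !permM.
  by rewrite [LHS](conf_Aut_colour IH) [LHS](conf_Aut_colour phi_aut).
(* Otherwise [w] and [phi w] would have the same stable colour seen from [u], hence coincide. *)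
have no_far u w : L < dist conn u w -> L < dist conn u (phi w) -> False.
  move=> far1 far2; have /eqP[] := phi_ff w; apply/esym.
  apply: (wl_stable_inj stable (conn u w)).
  apply: (@wl_iter_far _ _ <[phi]>%G (dist conn)) => //.
  - by move=> a /autA/conf_Aut_colour.
  - by move=> x y; apply: dist_sym.
  - by move=> y x z; apply: dist_triangle.
  - by move=> a /autA/conf_Aut_graph aut_a x y; apply: dist_perm.
  - by move=> x y x' y' /dist_gt1[? ?] /dist_gt1[? ?]; apply: nonadjacent_colour.
  - exact: cycle_id.
apply: diam_leP => v w; rewrite leqNgt; apply/negP => far_vw.
have near_v : dist conn v (phi w) <= L.
  by rewrite leqNgt; apply/negP; apply: no_far; lia.
have := dist_has_path conn v w.
(* Take [u] after [4 * L] steps of a geodesic from [v] to [w]: it is more than [4 * L] from [w], and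
   at least [3 * L] from [phi w], which is within [L] of [v]. *)
have -> : dist conn v w = 4 * L + (dist conn v w - 4 * L) by lia.
move=> /has_path_split[u /(dist_le conn) le_vu /(dist_le conn) le_uw].
have tri_vuw := dist_triangle conn u v w.
have tri_uw := dist_triangle conn (phi w) v u.
by apply: (no_far u w); last rewrite dist_sym //; lia.
Qed.

End Configuration.

(** * Passage to logarithms *)

Local Open Scope ring_scope.

Theorem theorem5 (R : realType) (G C : finType) (X : configuration G C)
  (one_empty : #|[set c0 : C | empty_colour X c0]| = 1%N)
  (conn : strongly_connected (conf_graph X))
  (phi : {perm G})
  (phi_ff : fixfree_aut X phi)
  (phi_min : forall psi : {perm G}, fixfree_aut X psi ->
     (#|<[phi]>%g| <= #|<[psi]>%g|)%N) :
  (WL X)%:R >=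
    log2 ((diam conn)%:R : R) - log2 ((#|<[phi]>%g|)%:R - 1) - 3%:R.
Proof.
have [phi_aut phi_neq1 phi_free] := phi_ff.
have le_diam : (diam conn <= 2 ^ (WL X + 3))%N.
  apply: (diam_le_WL one_empty conn phi_aut) => v.
  exact: phi_free (cycle_id phi) phi_neq1 v.
have ln2_gt0 : 0 < ln 2%:R :> R by rewrite ln_gt0 // ltr1n.
have order_gt1 : (1 < #|<[phi]>%g|)%N by rewrite cardG_gt1 cycle_eq1.
(* The order is at least 2, so subtracting this logarithm only lowers the bound. *)
have log_order : 0 <= log2 (#|<[phi]>%g|%:R - 1 : R).
  rewrite divr_ge0 ?(ltW ln2_gt0) // ln_ge0 // lerBrDr; move: order_gt1.
  by rewrite -(ler_nat R) -natr1.
suff : log2 ((diam conn)%:R : R) <= (WL X)%:R + 3%:R.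
  rewrite !lerBlDr => /le_trans; apply.
  by rewrite lerDl.
rewrite -natrD /log2 ler_pdivrMr // mulr_natl -lnXn ?ltr0n //.
(* For diameter 0 the convention [ln 0 = 0] applies. *)
have [->|diam_gt0] := posnP (diam conn).
  by rewrite ln0 // ln_ge0 // -natrX ler1n expn_gt0.
by rewrite ler_ln ?posrE -?natrX ?ltr0n ?expn_gt0 // ler_nat.
Qed.
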